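(* Let $q$ be an odd integer, $n=q^2+q+1$, $1\le t\le q$, and let $C_n(J)$, with $J\subseteq\{1,\dots,\lfloor n/2\rfloor\}$, be an $r$-regular circulant graph with $r=(q+1)t$. Suppose there is a difference set $D\subseteq\mathbb{Z}_n$ of size $q+1$ (giving a cyclic projective plane $\Pi_q$) such that the edges of the complete graph on vertex set $D$ whose lengths belong to $J$ form the union of $t$ pairwise edge-disjoint perfect matchings of this complete graph. Then \[\alpha_1(C_n(J))=tn.\]
   Context: A subset $D=\{d_0,\dots,d_q\}\subseteq\mathbb{Z}_n$ is a difference set if every nonzero $g\in\mathbb{Z}_n$ can be written uniquely as $g=d_i-d_j$ with $d_i\ne d_j$ in $D$; its translates $D+i$ ($i\in\mathbb{Z}_n$) are the lines of the cyclic projective plane on $\mathbb{Z}_n$. The length of a pair $\{x,y\}$ of distinct elements of $\mathbb{Z}_n$ is the unique $s\in\{1,\dots,\lfloor n/2\rfloor\}$ with $x-y\equiv\pm s\pmod n$. The circulant graph $C_n(J)$ has vertex set $\mathbb{Z}_n$, with $x,y$ adjacent iff the length of $\{x,y\}$ lies in $J$. A complete edge-coloring of a graph uses exactly $k$ colors such that for every pair of distinct colors there are two adjacent (sharing a vertex) edges receiving these colors; it is proper if adjacent edges receive distinct colors. The achromatic index $\alpha_1(G)$ is the largest $k$ such that $G$ has a proper complete edge-coloring with $k$ colors. *)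

(* Defs.v *)
From mathcomp Require Import all_boot all_order all_algebra.

Set Implicit Arguments.
Unset Strict Implicit.
Unset Printing Implicit Defensive.

Import GRing.Theory.

Section Graphs.
Variable T : finType.

Record sgraph := SGraph {
  adj :> rel T;
  adj_sym : symmetric adj;
  adj_irrefl : irreflexive adj }.

Implicit Type G : sgraph.

Definition edges G : {set {set T}} := [set [set x; y] | x in T, y in T & G x y].

Definition edge G : finType := {e : {set T} | e \in edges G}.

Definition regular G (r : nat) : Prop := forall x, #|[set y | G x y]| = r.

Definition edge_adj G (e f : edge G) : bool :=
  (e != f) && (val e :&: val f != set0).

Definition uses_all_colors G k (c : {ffun edge G -> 'I_k}) : bool :=
  [forall i, exists e, c e == i].

Definition proper_coloring G k (c : {ffun edge G -> 'I_k}) : bool :=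
  [forall e, forall f, edge_adj e f ==> (c e != c f)].

Definition complete_coloring G k (c : {ffun edge G -> 'I_k}) : bool :=
  uses_all_colors c &&
  [forall i, forall j, (i != j) ==>
    [exists e, exists f, [&& edge_adj e f, c e == i & c f == j]]].

Definition has_proper_complete_coloring G k : bool :=
  [exists c : {ffun edge G -> 'I_k}, proper_coloring c && complete_coloring c].

(* All k colors are used, so k never exceeds the number of edges: the bound
   on k below excludes nothing (achromatic_index_max). *)
Definition achromatic_index G : nat :=
  \max_(k < #|edges G|.+1 | has_proper_complete_coloring G k) k.

Lemma coloring_leq_edges G k :
  has_proper_complete_coloring G k -> k <= #|edges G|.
Proof.
case/existsP=> c /and3P[_ /forallP surj _].
rewrite -[k]card_ord -(card_sig (mem (edges G))).
apply: leq_trans (leq_image_card c predT).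
by apply/subset_leq_card/subsetP=> i _; have /existsP[e /eqP <-] := surj i;
  apply: image_f.
Qed.

Lemma achromatic_index_max G k :
  has_proper_complete_coloring G k -> k <= achromatic_index G.
Proof.
move=> ck; have lt_k : k < #|edges G|.+1 by rewrite ltnS coloring_leq_edges.
by rewrite /achromatic_index (bigD1 (Ordinal lt_k)) //= leq_maxl.
Qed.

Lemma achromatic_index_attained G k :
  has_proper_complete_coloring G k ->
  has_proper_complete_coloring G (achromatic_index G).
Proof.
move=> ck; have lt_k : k < #|edges G|.+1 by rewrite ltnS coloring_leq_edges.
by rewrite /achromatic_index (bigop.bigmax_eq_arg (Ordinal lt_k)) //;
  case: arg_maxnP.
Qed.

(* Perfect matchings of the complete graph with vertex set D: 2-subsets of D,
   pairwise disjoint, covering D. *)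
Definition perfect_matching (D : {set T}) (M : {set {set T}}) : bool :=
  (M \subset [set e : {set T} | (e \subset D) && (#|e| == 2)]) && partition M D.

End Graphs.

(* 'Z_n is the ring of integers modulo n only for n > 1. *)
Section Cyclic.
Local Open Scope ring_scope.
Variable n : nat.

Definition difference_set (D : {set 'Z_n}) : Prop :=
  forall g : 'Z_n, g != 0 ->
    exists! p : 'Z_n * 'Z_n,
      [/\ p.1 \in D, p.2 \in D, p.1 != p.2 & g = p.1 - p.2].

Definition is_length (x y : 'Z_n) (s : nat) : bool :=
  (1 <= s <= n./2)%N && ((x - y == s%:R) || (x - y == - s%:R)).

(* The default value 0 is taken only when x = y (pair_lengthP). *)
Definition pair_length (x y : 'Z_n) : nat :=
  if [pick s : 'I_(n./2).+1 | is_length x y s] is Some s then s : nat else 0%N.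

Lemma is_lengthC x y : is_length x y =1 is_length y x.
Proof.
by move=> s; rewrite /is_length -(opprB x y) eqr_opp eqr_oppLR orbC.
Qed.

Lemma pair_lengthC x y : pair_length x y = pair_length y x.
Proof.
by rewrite /pair_length; under eq_pick => s do rewrite is_lengthC.
Qed.

Lemma is_length_uniq x y s s' : (1 < n)%N ->
  is_length x y s -> is_length x y s' -> s = s'.
Proof.
move=> n_gt1.
have half m : (m <= n./2 -> m + m <= n)%N.
  by move=> le_m; rewrite addnn -[leqRHS]odd_double_half;
    apply: leq_trans (leq_addl _ _); rewrite leq_double.
have inj a b : (1 <= a <= n./2)%N -> (1 <= b <= n./2)%N ->
    a%:R = b%:R :> 'Z_n -> a = b.
  move=> /andP[a0 /half an] /andP[b0 /half bn] /(congr1 val) /=.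
  rewrite !val_Zp_nat // !modn_small //.
    by apply: leq_trans bn; rewrite -[ltnLHS]addn0 ltn_add2l.
  by apply: leq_trans an; rewrite -[ltnLHS]addn0 ltn_add2l.
have injN a b : (1 <= a <= n./2)%N -> (1 <= b <= n./2)%N ->
    a%:R = - b%:R :> 'Z_n -> a = b.
  move=> /andP[a0 /half an] /andP[b0 /half bn] /eqP.
  rewrite -addr_eq0 -natrD -(inj_eq val_inj) /= val_Zp_nat // => dv.
  have {}dv : (n %| a + b)%N by rewrite /dvdn.
  have le_n : (n <= a + b)%N by rewrite dvdn_leq // addn_gt0 a0.
  have [lt_ab|lt_ba|//] := ltngtP a b.
    have lt_n : (a + b < n)%N by apply: leq_trans bn; rewrite ltn_add2r.
    by have := leq_ltn_trans le_n lt_n; rewrite ltnn.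
  have lt_n : (a + b < n)%N by apply: leq_trans an; rewrite ltn_add2l.
  by have := leq_ltn_trans le_n lt_n; rewrite ltnn.
rewrite /is_length; case/andP=> hs /orP[]/eqP-> /andP[hs' /orP[]/eqP e].
- exact: inj.
- exact: injN.
- by apply: injN => //; rewrite -e opprK.
- by apply: inj => //; apply: oppr_inj.
Qed.

Lemma pair_lengthP x y s : (1 < n)%N -> x != y ->
  (pair_length x y == s) = is_length x y s.
Proof.
move=> n_gt1 neq_xy.
have len : is_length x y (pair_length x y).
  rewrite /pair_length; case: pickP => [s' //|none].
  pose a : nat := (x - y)%R; have aE : a%:R = x - y by rewrite natr_Zp.
  have lt_a : (a < n)%N by rewrite -[ltnRHS](Zp_cast n_gt1) ltn_ord.
  have a_gt0 : (0 < a)%N.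
    rewrite lt0n; apply: contraNneq neq_xy => a0.
    by rewrite -subr_eq0 -aE a0.
  have n_le : (n <= (n./2).+1 + n./2)%N.
    by rewrite -[leqLHS]odd_double_half -addnn addSn -add1n leq_add2r leq_b1.
  have [le_a|gt_a] := leqP a n./2.
    have := none (Ordinal (le_a : (a < (n./2).+1)%N)).
    by rewrite /is_length /= a_gt0 le_a aE eqxx.
  have le_b : (n - a <= n./2)%N.
    by rewrite leq_subLR (leq_trans n_le) // leq_add2r.
  have := none (Ordinal (le_b : (n - a < (n./2).+1)%N)).
  rewrite /is_length /= subn_gt0 lt_a le_b natrB 1?ltnW // aE.
  by rewrite pchar_Zp // sub0r opprK eqxx orbT.
by apply/eqP/idP=> [<- //|]; apply: is_length_uniq.
Qed.

Variable J : {pred nat}.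

Definition circulant_adj : rel 'Z_n :=
  fun x y => (x != y) && (pair_length x y \in J).

Lemma circulant_sym : symmetric circulant_adj.
Proof. by move=> x y; rewrite /circulant_adj eq_sym pair_lengthC. Qed.

Lemma circulant_irrefl : irreflexive circulant_adj.
Proof. by move=> x; rewrite /circulant_adj eqxx. Qed.

Definition circulant : sgraph 'Z_n := SGraph circulant_sym circulant_irrefl.

Definition edges_with_length_in (D : {set 'Z_n}) : {set {set 'Z_n}} :=
  [set [set x; y] | x in D, y in D & (x != y) && (pair_length x y \in J)].

End Cyclic.

(* Main.v *)
(** Lower bound: the translates [M i + a] of the given matchings are [t * n]
    color classes. An edge lies on a single line [D + a], hence in a single
    class; any two lines meet, and a class covers its line, so any two classes
    have adjacent edges.

    Upper bound: in a complete coloring with [k] colors, let [m] be the least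
    number of vertices that a color class touches. Every color occurs at one of
    these [m] vertices, so [k <= m * r]; counting pairs (vertex, color at this
    vertex) gives [k * m <= n * r]. Use the former bound if [m <= q], the latter
    if [m > q]. *)

Require Import Defs.
From mathcomp Require Import all_boot all_order all_algebra.

Set Implicit Arguments.
Unset Strict Implicit.
Unset Printing Implicit Defensive.

Import GRing.Theory.

(** * Complete colorings of a finite graph: construction from color classes, and a bound *)

Section Colorings.
Variables (T : finType) (G : sgraph T).

(** The edge [e] gets the only [c] with [e \in F c]. Disjointness within a class makes this proper,
    and a common vertex of two covers yields adjacent edges of the two colors. The case [c = d] of
    the last hypothesis makes every class nonempty, so all colors are used. *)
Lemma coloring_of_classes (C : finType) (F : C -> {set {set T}}) :
    (forall c, trivIset (F c)) ->
    (forall c, F c \subset edges G) ->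
    (forall e, e \in edges G -> exists! c, e \in F c) ->
    (forall c d, cover (F c) :&: cover (F d) != set0) ->
  has_proper_complete_coloring G #|C|.
Proof.
move=> trivF subF uniqF meetF.
have colP (e : edge G) : exists c, val e \in F c.
  by have [c [Fc _]] := uniqF _ (valP e); exists c.
pose col e := xchoose (colP e).
have colK e c : val e \in F c -> col e = c.
  have [d [_ uniq_d]] := uniqF _ (valP e); move=> /uniq_d <-.
  exact/esym/uniq_d/(xchooseP (colP e)).
have col_at x c : x \in cover (F c) -> exists2 e : edge G, x \in val e & col e = c.
  case/bigcupP=> e Fe xe; have Ee := subsetP (subF c) _ Fe.
  by exists (Sub e Ee) => //; apply: colK.
have color_at x i : x \in cover (F (enum_val i)) ->
    exists2 e : edge G, x \in val e & enum_rank (col e) = i.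
  by case/col_at=> e xe ce; exists e => //; rewrite ce enum_valK.
apply/existsP; exists [ffun e => enum_rank (col e)]; apply/and3P; split.
- apply/forallP=> e; apply/forallP=> f; apply/implyP=> /andP[neq_ef].
  apply: contraNneq; rewrite !ffunE => /enum_rank_inj eq_ef.
  have Fe := xchooseP (colP e); have Ff := xchooseP (colP f).
  rewrite -/(col e) in Fe; rewrite -/(col f) -eq_ef in Ff.
  by rewrite setI_eq0; apply: (trivIsetP (trivF _) _ _ Fe Ff).
- apply/forallP=> i; have /set0Pn[x /setIP[/color_at[e _ ei] _]] :=
    meetF (enum_val i) (enum_val i).
  by apply/existsP; exists e; rewrite ffunE ei.
apply/forallP=> i; apply/forallP=> j; apply/implyP=> neq_ij.
have /set0Pn[x /setIP[/color_at[e xe ei] /color_at[f xf fj]]] :=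
  meetF (enum_val i) (enum_val j).
apply/existsP; exists e; apply/existsP; exists f.
rewrite !ffunE ei fj !eqxx !andbT; apply/andP; split.
  by apply: contraNneq neq_ij => eq_ef; rewrite -ei -fj eq_ef.
by apply/set0Pn; exists x; rewrite inE xe.
Qed.

Section UpperBound.
Variables (r k : nat) (c : {ffun edge G -> 'I_k}).
Hypothesis regG : regular G r.

Definition colors_at (x : T) : {set 'I_k} := [set c e | e in [set e : edge G | x \in val e]].

Lemma card_colors_at x : #|colors_at x| <= r.
Proof.
apply: leq_trans (leq_imset_card _ _) _.
rewrite -(card_imset _ val_inj) -(regG x).
apply: leq_trans (leq_imset_card (fun y => [set x; y]) _).
apply/subset_leq_card/subsetP=> _ /imsetP[e + ->]; rewrite inE.
have /imset2P[y z _] := valP e; rewrite inE => /andP[_ Gyz] ->.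
rewrite !inE => /orP[]/eqP->.
  by apply/imsetP; exists z; rewrite ?inE.
by apply/imsetP; exists y; rewrite 1?setUC // inE adj_sym.
Qed.

Definition touched (i : 'I_k) : {set T} := [set x | i \in colors_at x].

(** Double counting of the pairs (vertex, color at this vertex). *)
Lemma sum_card_touched : \sum_i #|touched i| <= #|T| * r.
Proof.
rewrite -sum_nat_const.
under eq_bigr do rewrite cardsE -sum1_card big_mkcond.
rewrite exchange_big leq_sum // => x _.
by rewrite -big_mkcond sum1_card card_colors_at.
Qed.

(** Every color [j] occurs at a vertex touched by [i]: an end of an edge of color [i] if [j = i],
    otherwise the vertex shared by adjacent edges of colors [i] and [j]. At most [r] colors occur at
    each such vertex. *)
Lemma leq_card_touched i : complete_coloring c -> k <= #|touched i| * r.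
Proof.
case/andP=> /forallP used /forallP complete_c.
have meet_i j : exists2 x, x \in touched i & j \in colors_at x.
  have [<-|neq_ij] := eqVneq i j.
    have /existsP[e /eqP ei] := used i; have /imset2P[x y _ _ def_e] := valP e.
    have xi : i \in colors_at x.
      by apply/imsetP; exists e; rewrite // inE def_e !inE eqxx.
    by exists x; rewrite ?inE.
  have /forallP/(_ j) := complete_c i; rewrite neq_ij => /existsP[e /existsP[f]].
  case/and3P=> /andP[_ /set0Pn[x /setIP[xe xf]]] /eqP ei /eqP fj.
  exists x; first by rewrite inE; apply/imsetP; exists e; rewrite ?inE.
  by apply/imsetP; exists f; rewrite ?inE.
rewrite -sum_nat_const -[leqLHS]card_ord.
apply: (@leq_trans (\sum_(x in touched i) #|colors_at x|)); last first.
  by apply: leq_sum => x _; apply: card_colors_at.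
under eq_bigr do rewrite -sum1_card big_mkcond.
rewrite exchange_big -sum1_card leq_sum //= => j _.
by have [x ix jx] := meet_i j; rewrite (bigD1 x) //= jx.
Qed.

Lemma complete_coloring_bound :
  complete_coloring c -> exists m, k <= m * r /\ k * m <= #|T| * r.
Proof.
move=> complete_c; case: (pickP 'I_k) => [i0 _|no_color]; last first.
  (* Without colors there is no minimum to take, but then [k = 0]. *)
  by exists 0; rewrite -[k]card_ord (eq_card0 no_color).
case: (arg_minnP (fun i => #|touched i|) (erefl : xpredT i0)) => i _ min_i.
exists #|touched i|; split; first exact: leq_card_touched.
rewrite -[k in k * _]card_ord -sum_nat_const.
by apply: leq_trans sum_card_touched; apply: leq_sum => j _; apply: min_i.
Qed.

End UpperBound.
End Colorings.

(** * Lines of the cyclic plane and the translated matchings *)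

Section Planes.
Variable n : nat.
Implicit Types (x y a b : 'Z_n) (D e : {set 'Z_n}).
Local Open Scope ring_scope.

Definition translate a e : {set 'Z_n} := [set x + a | x in e].

Lemma mem_translate a e x : (x \in translate a e) = (x - a \in e).
Proof. by rewrite -{1}[x](subrK a); apply: (mem_imset _ _ (addIr a)). Qed.

Lemma pair_length_translate a x y : pair_length (x + a) (y + a) = pair_length x y.
Proof.
rewrite /pair_length; under eq_pick => s.
  rewrite /is_length opprD addrACA subrr addr0 -/(is_length x y s); over.
by [].
Qed.

Lemma translate_pair a x y : translate a [set x; y] = [set x + a; y + a].
Proof. by rewrite /translate imsetU1 imset_set1. Qed.

Variable D : {set 'Z_n}.
Hypothesis D_diff : difference_set D.

(** Here [x - a \in D] says that [x] lies on the line [D + a]. The unique representation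
    [x - y = d - d'] forces [x - a = d]. *)
Lemma unique_line x y : x != y -> exists! a, x - a \in D /\ y - a \in D.
Proof.
move=> neq_xy; have neq0 : x - y != 0 by rewrite subr_eq0.
have [[d d'] /= [[Dd Dd' _ def_xy] uniq_d]] := D_diff neq0.
exists (x - d); split=> [|a [Dxa Dya]].
  by rewrite subKr opprB addrCA -opprB def_xy opprB subrKC.
have /= := uniq_d (x - a, y - a).
rewrite opprB addrA subrK (inj_eq (addIr _)) => /(_ (And4 Dxa Dya neq_xy erefl)).
by case=> -> _; rewrite subKr.
Qed.

(** If [a - b = d - d'] with [d] and [d'] in [D], then [d' + a = d + b] is on both lines. *)
Lemma lines_meet a b : D != set0 -> exists2 x, x - a \in D & x - b \in D.
Proof.
case/set0Pn=> d0 Dd0; have [<-|neq_ab] := eqVneq a b.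
  by exists (d0 + a); rewrite addrK.
have neq0 : a - b != 0 by rewrite subr_eq0.
have [[d d'] /= [[Dd Dd' _ def_ab] _]] := D_diff neq0.
exists (d' + a); first by rewrite addrK.
by rewrite -addrA def_ab subrKC.
Qed.

Variable J : {pred nat}.
Variables (t : nat) (M : 'I_t -> {set {set 'Z_n}}).
Hypothesis M_perfect : forall i, perfect_matching D (M i).
Hypothesis M_disjoint : forall i j, i != j -> [disjoint M i & M j].
Hypothesis M_union : edges_with_length_in J D = \bigcup_(i < t) M i.
Hypothesis D_neq0 : D != set0.

Definition translated_matching (p : 'I_t * 'Z_n) : {set {set 'Z_n}} :=
  [set translate p.2 e | e in M p.1].

Lemma matchings_coloring :
  has_proper_complete_coloring (circulant n J) #|{: 'I_t * 'Z_n}|.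
Proof.
have M_edges i e : e \in M i -> e \in edges_with_length_in J D.
  by move=> Me; rewrite M_union; apply/bigcupP; exists i.
have M_cover i x : x \in D -> exists2 e, e \in M i & x \in e.
  have /andP[_ /and3P[/eqP <- _ _]] := M_perfect i.
  by case/bigcupP=> e; exists e.
have memF a x i : x - a \in D -> x \in cover (translated_matching (i, a)).
  case/(M_cover i)=> e Me xe; apply/bigcupP; exists (translate a e).
    exact: imset_f.
  by rewrite mem_translate.
apply: (coloring_of_classes (F := translated_matching)).
- case=> i a; apply/trivIsetP=> _ _ /imsetP[e Me ->] /imsetP[f Mf ->] neq_ef.
  have /andP[_ /and3P[_ /trivIsetP trivM _]] := M_perfect i.
  rewrite imset_disjoint; last exact: addIr.
  by apply: trivM => //; apply: contraNneq neq_ef => ->.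
- case=> i a; apply/subsetP=> _ /imsetP[e Me ->] /=.
  have /imset2P[x y Dx] := M_edges _ _ Me; rewrite inE => /and3P[Dy neq_xy Jxy] ->.
  rewrite translate_pair; apply: imset2_f; rewrite ?inE //=.
  by rewrite /circulant_adj pair_length_translate (inj_eq (addIr _)) neq_xy.
- move=> _ /imset2P[x y _ + ->]; rewrite inE => /andP[_ /andP[neq_xy Jxy]].
  have [a [[Dxa Dya] uniq_a]] := unique_line neq_xy.
  (* Moving the edge back by [a] puts it inside [D] and keeps its length, so some [M i] contains
     it. *)
  have : [set x - a; y - a] \in edges_with_length_in J D.
    apply: imset2_f; rewrite // inE Dya pair_length_translate.
    by rewrite (inj_eq (addIr _)) neq_xy.
  rewrite M_union => /bigcupP[i _ Mi]; exists (i, a); split=> [|[j b]].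
    by apply/imsetP; exists [set x - a; y - a] => //; rewrite translate_pair !subrK.
  (* For a second class [(j, b)], undoing the translation puts both ends on [D + b]. Hence [b = a],
     and disjointness of the matchings gives [j = i]. *)
  case/imsetP=> e /= Me def_e.
  have {def_e} e_def : e = [set x - b; y - b].
    apply/setP=> z; rewrite -[z](addrK b) -mem_translate -def_e !inE.
    by rewrite !(inj_eq (addIr (- b))).
  have D_e : {subset e <= D}.
    have /andP[/subsetP/(_ e Me)] := M_perfect j.
    by rewrite inE => /andP[/subsetP].
  have eq_ab : a = b by apply: uniq_a; split; apply: D_e; rewrite e_def !inE eqxx ?orbT.
  rewrite -eq_ab; congr pair; apply: contraTeq Mi => neq_ij.
  by rewrite (disjointFl (M_disjoint neq_ij)) // eq_ab -e_def.
move=> [i a] [j b]; have [x Dxa Dxb] := lines_meet a b D_neq0.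
by apply/set0Pn; exists x; rewrite inE !memF.
Qed.

End Planes.

Theorem theorem10 (q n t : nat) (J : {pred nat}) (D : {set 'Z_n})
  (q_odd : odd q)
  (n_def : n = q ^ 2 + q + 1)
  (t_bounds : 1 <= t <= q)
  (J_bounds : forall s : nat, s \in J -> 1 <= s <= n./2)
  (C_regular : regular (circulant n J) ((q + 1) * t))
  (D_size : #|D| = q + 1)
  (D_diff : difference_set D)
  (D_matchings : exists M : 'I_t -> {set {set 'Z_n}},
    [/\ forall i, perfect_matching D (M i),
        forall i j, i != j -> [disjoint M i & M j]
      & edges_with_length_in J D = \bigcup_(i < t) M i]) :
  achromatic_index (circulant n J) = t * n.
Proof.
(* Oddness excludes [q = 0], where [n = 1] and ['Z_n] would have two elements. *)
have n_gt1 : 1 < n by rewrite n_def; case: (q) q_odd => // p _; rewrite addn1 addnS.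
have card_Zn : #|{: 'Z_n}| = n by rewrite card_ord Zp_cast.
apply/eqP; rewrite eqn_leq; apply/andP; split.
  apply/bigmax_leqP=> k /existsP[c /andP[_ /(complete_coloring_bound C_regular)]].
  case=> m []; rewrite card_Zn; move: (nat_of_ord k) => {c}k le_k le_km.
  have [le_mq | lt_qm] := leqP m q.
    (* Here [k <= q * (q + 1) * t], and [q * (q + 1) = n - 1]. *)
    apply: leq_trans le_k _; apply: leq_trans (leq_mul le_mq (leqnn _)) _.
    by rewrite mulnA mulnC leq_mul2l n_def mulnDr muln1 mulnn leq_addr orbT.
  have q1_gt0 : 0 < q + 1 by rewrite addn1.
  (* Here [k * (q + 1) <= k * m <= n * ((q + 1) * t)], and [q + 1] cancels. *)
  rewrite -(leq_pmul2r q1_gt0) -mulnA mulnCA [t * _]mulnC.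
  by apply: leq_trans le_km; rewrite leq_mul2l addn1 lt_qm orbT.
have [M [M_perfect M_disjoint M_union]] := D_matchings.
have D_neq0 : D != set0 by rewrite -card_gt0 D_size addn1.
apply: achromatic_index_max.
have := matchings_coloring D_diff M_perfect M_disjoint M_union D_neq0.
by rewrite card_prod card_ord card_Zn.
Qed.
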